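(* Let $\mathcal{G}$ be a compact group acting continuously on a sample space $\mathcal{Y}$, let $Y$ denote the data, a random variable on $\mathcal{Y}$, with orbit $O_Y$, and let $\varepsilon : \mathcal{Y} \to [0,\infty]$. Then: (i) $\varepsilon$ is a valid e-value for $\mathcal{G}$ invariance if and only if $\mathbb{E}^{\mathrm{Unif}(O_Y)}[\varepsilon] \leq 1$, $O_Y$-a.s.; (ii) $\varepsilon$ is an exact e-value for $\mathcal{G}$ invariance if and only if $\mathbb{E}^{\mathrm{Unif}(O_Y)}[\varepsilon] = 1$, $O_Y$-a.s.
   Context: All spaces are second-countable locally compact Hausdorff, equipped with their Borel $\sigma$-algebras, and functions are measurable. The hypothesis being tested is that the data $Y$ is drawn from some $\mathcal{G}$ invariant distribution. The orbit of $y$ is $O_y = \{Gy : G \in \mathcal{G}\}$; the orbits partition $\mathcal{Y}$, so that $Y$ lands in exactly one orbit $O_Y$. $\overline{G}$ denotes a random element distributed according to the Haar probability measure on $\mathcal{G}$. For an orbit $O$, $\mathrm{Unif}(O)$ is the unique $\mathcal{G}$ invariant probability on $O$, i.e. the law of $\overline{G}y$ for any $y \in O$, so that $\mathbb{E}^{\mathrm{Unif}(O)}[\varepsilon] = \mathbb{E}_{\overline{G}}[\varepsilon(\overline{G}y)]$ for $y \in O$. A probability measure $\mathbb{P}$ on $\mathcal{Y}$ is $\mathcal{G}$ invariant if $\mathbb{P}(G^{-1}A) = \mathbb{P}(A)$ for all $G \in \mathcal{G}$ and all events $A$. An e-value $\varepsilon$ is valid for $\mathcal{G}$ invariance if $\mathbb{E}^{\mathbb{P}}[\varepsilon]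 \leq 1$ for every $\mathcal{G}$ invariant probability $\mathbb{P}$; it is exact if $\mathbb{E}^{\mathbb{P}}[\varepsilon] = 1$ for every $\mathcal{G}$ invariant probability $\mathbb{P}$. ''$O_Y$-a.s.'' means almost surely in the random orbit $O_Y$. *)

(* Defs.v *)
From HB Require Import structures.
From mathcomp Require Import all_boot all_order all_algebra.
From mathcomp Require Import all_classical all_reals all_analysis.
From mathcomp Require Import measurable_realfun.

Set Implicit Arguments.
Unset Strict Implicit.
Unset Printing Implicit Defensive.

Import Order.TTheory GRing.Theory Num.Theory.
Local Open Scope classical_set_scope.
Local Open Scope ereal_scope.

(* The library only has additive topological groups. The base point comes from
   [Pointed], which measurable types require; it is unrelated to the group
   structure, and nothing is assumed about it. *)
HB.mixin Record isTopologicalGroup G of PointedTopological G & Group G := {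
  mulg_continuous : continuous (fun x : G * G => (x.1 * x.2)%g) ;
  invg_continuous : continuous (fun x : G => (x^-1)%g)
}.

#[short(type="topologicalGroupType")]
HB.structure Definition TopologicalGroup :=
  {G of PointedTopological G & Group G & isTopologicalGroup G}.

Definition second_countable_lch (X : topologicalType) : Prop :=
  [/\ @second_countable X, locally_compact [set: X] & hausdorff_space X].

Notation borel X := (g_sigma_algebraType (@open X)).

Lemma continuous_borel_measurable (X Y : ptopologicalType) (f : X -> Y) :
  continuous f -> measurable_fun [set: borel X] (f : borel X -> borel Y).
Proof.
move=> cf; apply: (@measurability _ _ (borel X) (borel Y) setT f (@open Y)) => //.
move=> _ [B oB <-]; rewrite setTI; apply: sub_sigma_algebra.
by move/continuousP: cf; apply.
Qed.

Record continuous_action (G : topologicalGroupType) (T : ptopologicalType) :=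
  ContinuousAction {
    act :> G -> T -> T ;
    act1 : forall y, act 1%g y = y ;
    actM : forall g h y, act (g * h)%g y = act g (act h y) ;
    act_continuous : continuous (fun x : G * T => act x.1 x.2)
  }.

Definition orbit (G : topologicalGroupType) (T : ptopologicalType)
  (a : continuous_action G T) (y : T) : set T := range (fun g => a g y).

Definition orbit_map (G : topologicalGroupType) (T : ptopologicalType)
  (a : continuous_action G T) (y : T) : borel G -> borel T := fun g => a g y.

Lemma orbit_map_continuous (G : topologicalGroupType) (T : ptopologicalType)
  (a : continuous_action G T) (y : T) : continuous (fun g : G => a g y).
Proof.
move=> g.
apply: (@continuous_comp _ _ _ (fun g : G => (g, y)) (fun x => a x.1 x.2)).
  by apply: cvg_pair; [exact: cvg_id|exact: cvg_cst].
exact: act_continuous.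
Qed.

HB.instance Definition _ (G : topologicalGroupType) (T : ptopologicalType)
    (a : continuous_action G T) (y : T) :=
  isMeasurableFun.Build _ _ (borel G) (borel T) (orbit_map a y)
    (continuous_borel_measurable (@orbit_map_continuous G T a y)).

(* Existence and uniqueness of such a probability on a compact group are
   classical; Borel measures are automatically regular here since the groups
   considered are second countable. *)
Definition haar_probability (R : realType) (G : topologicalGroupType)
    (mu : probability (borel G) R) : Prop :=
  forall (g : G) (A : set (borel G)), measurable A ->
    mu ((fun x => (g * x)%g) @` A) = mu A.

Definition invariant_probability (R : realType) (G : topologicalGroupType)
    (T : ptopologicalType) (a : continuous_action G T)
    (P : probability (borel T) R) : Prop :=
  forall (g : G) (A : set (borel T)), measurable A ->
    P (a g^-1%g @` A) = P A.

(* Unif(O) as the law of [a g y] for [g] drawn from [mu] and some [y] in [O].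
   When [mu] is Haar it depends only on the orbit [O], not on the chosen [y]. *)
Definition unif (R : realType) (G : topologicalGroupType)
    (T : ptopologicalType) (a : continuous_action G T)
    (mu : probability (borel G) R) (O : set T) : probability (borel T) R :=
  distribution mu (orbit_map a (get O)).

Definition valid_evalue (R : realType) (G : topologicalGroupType)
    (T : ptopologicalType) (a : continuous_action G T)
    (eps : borel T -> \bar R) : Prop :=
  forall P : probability (borel T) R, invariant_probability a P ->
    \int[P]_y eps y <= 1.

Definition exact_evalue (R : realType) (G : topologicalGroupType)
    (T : ptopologicalType) (a : continuous_action G T)
    (eps : borel T -> \bar R) : Prop :=
  forall P : probability (borel T) R, invariant_probability a P ->
    \int[P]_y eps y = 1.

(* Q(O_Y) holds almost surely, whatever the invariant law of the data Y: the
   law of Y is only known to belong to the hypothesis being tested. *)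
Definition orbit_almost_surely (R : realType) (G : topologicalGroupType)
    (T : ptopologicalType) (a : continuous_action G T)
    (Q : set T -> Prop) : Prop :=
  forall (d : measure_display) (Omega : measurableType d)
    (P : probability Omega R) (Y : {RV P >-> borel T}),
    invariant_probability a (distribution P Y) ->
    {ae P, forall w, Q (orbit a (Y w))}.

(* Main.v *)
Require Import Defs.
From mathcomp Require Import all_boot all_order all_algebra.
From mathcomp Require Import all_classical all_reals all_analysis.
From mathcomp Require Import measurable_realfun.

(** The key identity is that, for every invariant probability [P] on [T],

      [\int[P] eps = \int[P]_y (\int[unif (orbit y)] eps)],

    that is, an invariant law is the mixture of the uniform laws on its orbits
    ([integral_invariant]).  It follows from Tonelli's theorem: the inner
    integral is the Haar average of [g |-> eps (g y)], and once the order of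
    integration is exchanged, each [\int[P]_y eps (g y)] equals
    [\int[P] eps] by invariance of [P].  Hence if the orbit averages are almost
    surely at most 1 (or equal to 1), so is the mean of [eps] under [P].

    Conversely, [unif O] is itself an invariant probability
    ([unif_invariant]), so a valid (or exact) e-value satisfies the orbitwise
    condition on every orbit, not just on almost every one.

    Two points need work.  Tonelli's theorem requires [(g, y) |-> g y] to be
    measurable for the product of the two Borel sigma-algebras, whereas
    continuity only makes it measurable for the Borel sigma-algebra of the
    product topology; second countability makes the two coincide
    ([open_prod_measurable]).  And [unif] is defined from a chosen point of the
    orbit; replacing this point by [y] multiplies the random group element on
    the right, whereas Haar probabilities are only assumed left invariant.  They
    are invariant under inversion, hence right invariant
    ([haar_integral_invg], [haar_integral_mulgr]). *)

Set Implicit Arguments.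
Unset Strict Implicit.
Unset Printing Implicit Defensive.

Local Open Scope classical_set_scope.
Local Open Scope ereal_scope.

(** * Joint measurability of continuous maps *)

(** An open subset of the product is the union of the basic rectangles that it
    contains, and there are only countably many basic rectangles. *)
Lemma open_prod_measurable (X Y : ptopologicalType) (U : set (X * Y)) :
  @second_countable X -> @second_countable Y ->
  open U -> measurable (U : set (borel X * borel Y)).
Proof.
move=> [BX cBX [oBX bX]] [BY cBY [oBY bY]] oU.
pose D := [set A : set X * set Y |
  [/\ BX A.1, BY A.2 & forall z, A.1 z.1 -> A.2 z.2 -> U z]].
have cD : countable D.
  apply: sub_countable (countableX cBX cBY).
  by apply: subset_card_le => -[A B] [].
have -> : U = \bigcup_(A in D) (A.1 `*` A.2).
  apply/seteqP; split=> [[x y] Uxy|z [A [_ _ AU] [/AU]]]; last exact.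
  have := oU; rewrite openE => /(_ _ Uxy).
  move=> -[[V W] /= [/bX[A [BA Ax] AV] /bY[B [BB By] BW]] VWU].
  exists (A, B) => //=; split=> //= -[u v] /= Au Bv; apply: VWU; split => /=.
    exact: AV.
  exact: BW.
rewrite bigcup_set_type; apply: countable_bigcupT_measurable.
  by rewrite (eq_countable (card_setT D)).
move=> -[[A B]] /set_mem [/= BA BB _]; apply: measurableX.
  by apply: sub_sigma_algebra; apply: oBX.
by apply: sub_sigma_algebra; apply: oBY.
Qed.

Lemma continuous_prod_measurable (X Y Z : ptopologicalType) (f : X * Y -> Z) :
  @second_countable X -> @second_countable Y -> continuous f ->
  measurable_fun [set: borel X * borel Y] (f : borel X * borel Y -> borel Z).
Proof.
move=> cX cY cf.
apply: (@measurability _ _ (borel X * borel Y)%type (borel Z) setT f (@open Z)) => //.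
move=> _ [B oB <-]; rewrite setTI.
apply: open_prod_measurable => //.
by move/continuousP: cf; apply.
Qed.

(** * Integrals against probability measures *)

Lemma ge0_integral_preserved {d : measure_display} {X : measurableType d}
    {R : realType} (P : probability X R) (phi : X -> X) (f : X -> \bar R) :
  measurable_fun setT phi ->
  (forall A, measurable A -> P (phi @^-1` A) = P A) ->
  measurable_fun setT f -> (forall x, 0 <= f x) ->
  \int[P]_x f (phi x) = \int[P]_x f x.
Proof.
move=> mphi Pphi mf f0.
have <- : \int[pushforward P phi]_x f x = \int[P]_x f x.
  by apply: eq_measure_integral => A mA _; exact: Pphi.
by rewrite ge0_integral_pushforward.
Qed.

Lemma integral_probability_cst {d : measure_display} {X : measurableType d}
    {R : realType} (P : probability X R) (c : \bar R) : \int[P]_x c = c.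
Proof. by rewrite integral_cst // [X in _ * X]probability_setT mule1. Qed.

(** * Unimodularity of Haar probabilities *)

Section haar.
Context {R : realType} {G : topologicalGroupType}.
Hypothesis hG : @second_countable G.
Variable mu : probability (borel G) R.
Hypothesis hmu : haar_probability mu.

Lemma measurable_mulg :
  measurable_fun [set: borel G * borel G]
    ((fun x => (x.1 * x.2)%g) : borel G * borel G -> borel G).
Proof. by apply: continuous_prod_measurable => //; exact: mulg_continuous. Qed.

Lemma measurable_invg :
  measurable_fun [set: borel G] ((fun x => (x^-1)%g) : borel G -> borel G).
Proof. exact: (continuous_borel_measurable invg_continuous). Qed.

Lemma measurable_mulgl (g : G) :
  measurable_fun [set: borel G] ((fun x => (g * x)%g) : borel G -> borel G).
Proof. exact: (measurable_fun_pair2 _ measurable_mulg). Qed.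

Lemma measurable_mulgr (g : G) :
  measurable_fun [set: borel G] ((fun x => (x * g)%g) : borel G -> borel G).
Proof. exact: (measurable_fun_pair1 _ measurable_mulg). Qed.

Lemma haar_preimage_mulgl (g : G) (A : set (borel G)) : measurable A ->
  mu ((fun x : borel G => (g * x)%g : borel G) @^-1` A) = mu A.
Proof.
move=> mA; rewrite -[RHS](hmu g^-1%g mA); congr (mu _).
apply/seteqP; split=> [x /= Ax|_ [x Ax <-] /=]; last by rewrite mulVKg.
by exists (g * x)%g => //; rewrite mulKg.
Qed.

Lemma haar_integral_mulgl (f : borel G -> \bar R) (g : G) :
  measurable_fun [set: borel G] f -> (forall x, 0 <= f x) ->
  \int[mu]_x f (g * x)%g = \int[mu]_x f x.
Proof.
move=> mf f0; apply: ge0_integral_preserved => //; first exact: measurable_mulgl.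
exact: haar_preimage_mulgl.
Qed.

(** Averaging [f ((y^-1 x)^-1) = f (x^-1 y)] over both variables gives
    [\int f (x^-1)] when [x] is integrated first and [\int f] when [y] is, in
    both cases by left invariance. *)
Lemma haar_integral_invg (f : borel G -> \bar R) :
  measurable_fun [set: borel G] f -> (forall x, 0 <= f x) ->
  \int[mu]_x f (x^-1)%g = \int[mu]_x f x.
Proof.
move=> mf f0.
have mfV : measurable_fun [set: borel G] (fun x : borel G => f (x^-1)%g).
  exact: (measurableT_comp mf measurable_invg).
have fV0 x : 0 <= f (x^-1)%g by [].
have mulVgl y : \int[mu]_x f ((y^-1 * x)^-1)%g = \int[mu]_x f (x^-1)%g.
  exact: (haar_integral_mulgl y^-1%g mfV fV0).
transitivity (\int[mu]_y \int[mu]_x f ((y^-1 * x)^-1)%g).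
  under [RHS]eq_integral do rewrite mulVgl.
  by rewrite integral_probability_cst.
under eq_integral do under eq_integral do rewrite invgM invgK.
pose h (z : borel G * borel G) := f (z.2^-1 * z.1)%g.
have mh : measurable_fun [set: borel G * borel G] h.
  have mp : measurable_fun [set: borel G * borel G]
      (fun z : borel G * borel G => ((z.2^-1)%g : borel G, z.1)).
    apply/measurable_fun_pairP; split; last exact: measurable_fst.
    exact: (measurableT_comp measurable_invg measurable_snd).
  exact: (measurableT_comp mf (measurableT_comp measurable_mulg mp)).
rewrite (fubini_tonelli h) //; last by move=> z; exact: f0.
have mulglV y : \int[mu]_x h (x, y) = \int[mu]_x f x.
  exact: (haar_integral_mulgl y^-1%g mf f0).
under eq_integral do rewrite mulglV.
by rewrite integral_probability_cst.
Qed.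

(** Inversion conjugates right translations into left translations. *)
Lemma haar_integral_mulgr (f : borel G -> \bar R) (g : G) :
  measurable_fun [set: borel G] f -> (forall x, 0 <= f x) ->
  \int[mu]_x f (x * g)%g = \int[mu]_x f x.
Proof.
move=> mf f0.
have mfg : measurable_fun [set: borel G] (fun x : borel G => f (x * g)%g).
  exact: (measurableT_comp mf (measurable_mulgr g)).
have mfV : measurable_fun [set: borel G] (fun x : borel G => f (x^-1)%g).
  exact: (measurableT_comp mf measurable_invg).
rewrite -(haar_integral_invg mfg) // -[RHS](haar_integral_invg mf) //.
rewrite -[RHS](haar_integral_mulgl g^-1%g mfV) //=.
by apply: eq_integral => x _; rewrite invgM invgK.
Qed.

End haar.

(** * Uniform laws on orbits *)

Section orbit_average.
Context {R : realType} {G : topologicalGroupType} {T : ptopologicalType}.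
Variable a : continuous_action G T.

Lemma measurable_act (g : G) :
  measurable_fun [set: borel T] (a g : borel T -> borel T).
Proof.
apply: continuous_borel_measurable => y.
apply: (@continuous_comp _ _ _ (fun y : T => (g, y)) (fun x => a x.1 x.2)).
  by apply: cvg_pair; [exact: cvg_cst|exact: cvg_id].
exact: act_continuous.
Qed.

Lemma act_image_preimage (g : G) (A : set T) : a g^-1%g @` A = a g @^-1` A.
Proof.
apply/seteqP; split=> [_ [y Ay <-]|y Ay] /=.
  by rewrite -actM mulgV act1.
by exists (a g y) => //; rewrite -actM mulVg act1.
Qed.

(** The data may be taken to be the identity on [T] under the law [P]. *)
Lemma invariant_ae (P : probability (borel T) R) (Q : set T -> Prop) :
  orbit_almost_surely R a Q -> invariant_probability a P ->
  {ae P, forall y, Q (Defs.orbit a y)}.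
Proof.
move=> asQ iP.
pose Y : {RV P >-> borel T} := mfun_Sub (mem_set (@measurable_id _ (borel T) setT)).
by apply: (asQ _ _ P Y).
Qed.

Hypotheses (hG : @second_countable G) (hT : @second_countable T).
Variable mu : probability (borel G) R.
Hypothesis hmu : haar_probability mu.

(** The orbit map is equivariant, so left invariance of [mu] passes to its image. *)
Lemma unif_invariant (O : set T) : invariant_probability a (unif a mu O).
Proof.
move=> g A mA; rewrite act_image_preimage.
rewrite /unif /distribution /pushforward -[RHS](haar_preimage_mulgl hmu g).
  by congr (mu _); apply/seteqP; split=> x /=; rewrite /orbit_map actM.
rewrite -[X in measurable X]setTI.
by apply: (measurable_funPT (orbit_map a (get O))).
Qed.

Variable eps : borel T -> \bar R.
Hypothesis eps_ge0 : forall y, 0 <= eps y.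
Hypothesis eps_meas : measurable_fun [set: borel T] eps.

(** The point chosen by [unif] in the orbit of [y] is [h y] for some [h], and
    right invariance absorbs this [h]. *)
Lemma integral_unif_orbit (y : T) :
  \int[unif a mu (Defs.orbit a y)]_z eps z = \int[mu]_g eps (a g y).
Proof.
have [h _ hy] : Defs.orbit a y (get (Defs.orbit a y)).
  by apply: getPex; exists (a 1%g y), 1%g.
rewrite /unif ge0_integral_distribution // /orbit_map -hy.
rewrite -[RHS](haar_integral_mulgr hG hmu h) //.
  by apply: eq_integral => g _; rewrite /= actM.
exact: (measurableT_comp eps_meas (measurable_funPT (orbit_map a y))).
Qed.

Lemma measurable_eps_act :
  measurable_fun [set: borel G * borel T]
    (fun z : borel G * borel T => eps (a z.1 z.2)).
Proof.
apply: (measurableT_comp eps_meas).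
by apply: continuous_prod_measurable => //; exact: act_continuous.
Qed.

Lemma measurable_integral_unif_orbit :
  measurable_fun [set: borel T]
    (fun y : borel T => \int[unif a mu (Defs.orbit a y)]_z eps z).
Proof.
under eq_fun do rewrite integral_unif_orbit.
by apply: measurable_fun_fubini_tonelli_G measurable_eps_act _.
Qed.

(** Both sides equal the double integral of [eps (g y)] over [mu] and [P]:
    integrating [y] first gives the left side, [g] first the right side. *)
Lemma integral_invariant (P : probability (borel T) R) :
  invariant_probability a P ->
  \int[P]_y eps y = \int[P]_y \int[unif a mu (Defs.orbit a y)]_z eps z.
Proof.
move=> iP; under [RHS]eq_integral do rewrite integral_unif_orbit.
rewrite -(fubini_tonelli (fun z : borel G * borel T => eps (a z.1 z.2)));
  [|exact: measurable_eps_act|by move=> z; exact: eps_ge0].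
have actP g : \int[P]_y eps (a g y) = \int[P]_y eps y.
  apply: ge0_integral_preserved => //; first exact: measurable_act.
  by move=> A mA; rewrite -act_image_preimage; exact: iP.
under [RHS]eq_integral do rewrite /= actP.
by rewrite integral_probability_cst.
Qed.

End orbit_average.

Theorem corollary1 (R : realType) (G : topologicalGroupType)
    (T : ptopologicalType)
    (hG : second_countable_lch G) (cG : compact [set: G])
    (hT : second_countable_lch T)
    (a : continuous_action G T)
    (mu : probability (borel G) R) (hmu : haar_probability mu)
    (eps : borel T -> \bar R) (eps_ge0 : forall y, 0 <= eps y)
    (eps_meas : measurable_fun [set: borel T] eps) :
  (valid_evalue a eps <->
     orbit_almost_surely R a (fun O => \int[unif a mu O]_y eps y <= 1)) /\
  (exact_evalue a eps <->
     orbit_almost_surely R a (fun O => \int[unif a mu O]_y eps y = 1)).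
Proof.
case: hG => {}hG _ _; case: hT => {}hT _ _.
have mF := measurable_integral_unif_orbit a hG hT hmu eps_ge0 eps_meas.
split; split.
- move=> veps d Omega P Y _; apply: aeW => w.
  exact/veps/unif_invariant.
- move=> asQ P iP; rewrite (integral_invariant hG hT hmu _ _ iP) //.
  rewrite -[X in _ <= X](integral_probability_cst P).
  apply: ae_ge0_le_integral => //; first by move=> y _; exact: integral_ge0.
  apply: (@filterS _ _ (ae_filter_ringOfSetsType P) _ _ _ (invariant_ae asQ iP)).
  by move=> y le1 _.
- move=> xeps d Omega P Y _; apply: aeW => w.
  exact/xeps/unif_invariant.
- move=> asQ P iP; rewrite (integral_invariant hG hT hmu _ _ iP) //.
  rewrite -[RHS](integral_probability_cst P).
  apply: ae_eq_integral => //.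
  apply: (@filterS _ _ (ae_filter_ringOfSetsType P) _ _ _ (invariant_ae asQ iP)).
  by move=> y eq1 _.
Qed.
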